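(* There is an anti-even-balancing labelling $\sigma_{\overline{\mathbb{C}_3}}$ of $\overline{\mathbb{C}_3}$ such that for every finite graph $G$ with no independent set of size $3$ and every anti-even-balancing labelling $\sigma_G$ of $G$ there is a label-preserving embedding $f\colon (G,\sigma_G)\to(\overline{\mathbb{C}_3},\sigma_{\overline{\mathbb{C}_3}})$, i.e., an isomorphism $f$ of $G$ onto an induced subgraph of $\overline{\mathbb{C}_3}$ with $\sigma_{\overline{\mathbb{C}_3}}(f(x)f(y))=\sigma_G(xy)$ for every edge $xy\in E(G)$.
   Context: The graph $\mathbb{C}_3$ has as vertices the unit complex numbers with rational argument (the range of $\arg$ is $(-\pi,\pi]$), and two distinct vertices $z,w$ are adjacent if and only if $|\arg(z/w)|>\frac{2}{3}\pi$; $\overline{\mathbb{C}_3}$ denotes its complement graph. A labelling of a graph $G$ is a function $\sigma\colon E(G)\to\mathbb{Z}_2$; for a subgraph $H$ put $\sigma(H)=\sum_{e\in E(H)}\sigma(e)$ in $\mathbb{Z}_2$. A labelling $\sigma$ of $G$ is anti-even-balancing if for every induced cycle $C$ of $G$ we have $\sigma(C)=0$ when $C$ has $3$ vertices and $\sigma(C)=1$ otherwise. *)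

(* Defs.v *)
From HB Require Import structures.
From mathcomp Require Import all_boot all_order all_algebra.
From mathcomp Require Import all_classical all_reals all_analysis.
From mathcomp Require Import complex.

Set Implicit Arguments.
Unset Strict Implicit.
Unset Printing Implicit Defensive.

Import Order.TTheory GRing.Theory Num.Theory.

Local Open Scope classical_set_scope.
Local Open Scope ring_scope.
Local Open Scope complex_scope.

Section Argument.
Variable R : realType.
Implicit Types (z : R[i]) (t s : R).

Definition is_arg z t : Prop :=
  - pi < t <= pi /\ z = `|z| * (cos t +i* sin t).

Definition arg z : R := xget 0 [set t | is_arg z t].

Lemma cos_sin_inj t s : - pi < t <= pi -> - pi < s <= pi ->
  cos t = cos s -> sin t = sin s -> t = s.
Proof.
wlog le_st : t s / s <= t.
  move=> H ht hs hc hS; case: (leP s t) => [|/ltW] le; first exact: H.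
  by apply/esym/H.
move=> /andP[t1 t2] /andP[s1 s2] hc hS.
case: (leP 0 s) => s0.
  apply: cos_inj => //; rewrite in_itv /= ?t2 ?s2 ?s0 ?andbT //.
  exact: le_trans s0 le_st.
have sneg : sin s < 0.
  by rewrite -oppr_gt0 -sinN sin_gt0_pi // oppr_gt0 s0 ltrNl.
case: (leP 0 t) => t0.
  by have := sin_ge0_pi (x := t); rewrite t0 t2 hS leNgt sneg => /(_ isT).
apply: oppr_inj; apply: cos_inj; rewrite ?cosN // in_itv /= oppr_ge0.
  by rewrite (ltW t0) lerNl ltW.
by rewrite (ltW s0) lerNl ltW.
Qed.

Lemma is_arg_inj z t s : z != 0 -> is_arg z t -> is_arg z s -> t = s.
Proof.
move=> z0 [ht et] [hs es].
have /mulfI inj : `|z| != 0 by rewrite normr_eq0.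
have /eqP : cos t +i* sin t = cos s +i* sin s :> R[i].
  by apply: inj; rewrite -et -es.
by rewrite eq_complex /= => /andP[/eqP hc /eqP hS]; exact: cos_sin_inj.
Qed.

Lemma unit_cos_sin (x y : R) : x ^+ 2 + y ^+ 2 = 1 ->
  exists2 t, - pi < t <= pi & x = cos t /\ y = sin t.
Proof.
move=> xy1.
have x1 : -1 <= x <= 1.
  rewrite -ler_norml -(@expr_le1 _ 2) // real_normK ?num_real //.
  by rewrite -xy1 lerDl sqr_ge0.
have [/andP[a0 a1] ac] := acos_def x1.
have sa : sin (acos x) = `|y|.
  by rewrite sin_acos // -xy1 addrC addKr sqrtr_sqr.
case: (leP 0 y) => y0.
  exists (acos x); last by rewrite sa ger0_norm.
  by rewrite a1 andbT (lt_le_trans _ a0) // oppr_lt0 pi_gt0.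
exists (- acos x); last by rewrite cosN sinN sa ltr0_norm ?opprK.
rewrite ltrN2 (le_trans _ (pi_ge0 R)) ?oppr_le0 // andbT lt_neqAle a1 andbT.
apply: contraTneq y0 => api; rewrite -leNgt.
by move: sa; rewrite api sinpi => /esym/normr0_eq0 ->.
Qed.

Lemma is_arg_ex z : exists t, is_arg z t.
Proof.
have [->|z0] := eqVneq z 0.
  by exists 0; split; rewrite ?normr0 ?mul0r // oppr_lt0 pi_gt0 pi_ge0.
have nz0 : `|z| != 0 by rewrite normr_eq0.
pose u := z / `|z|.
have : `|u| = 1 by rewrite normrM normfV normr_id divff.
have zu : z = `|z| * u by rewrite mulrC divfK.
case: u zu => x y zu; rewrite normc_def /= => /eqP.
rewrite eq_complex /= eqxx andbT => /eqP h.
have /unit_cos_sin[t ht [hx hy]] : x ^+ 2 + y ^+ 2 = 1.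
  by rewrite -[LHS]sqr_sqrtr ?addr_ge0 ?sqr_ge0 // h expr1n.
by exists t; split; rewrite // -hx -hy.
Qed.

Lemma argP z : is_arg z (arg z).
Proof. by have [t ht] := is_arg_ex z; exact: (xgetI 0 ht). Qed.

Lemma norm_argV z : `|z| = 1 -> `|arg z^-1| = `|arg z|.
Proof.
move=> z1.
have z0 : z != 0 by rewrite -normr_eq0 z1 oner_eq0.
have [/andP[a1 a2] ez] := argP z.
have eV : z^-1 = cos (arg z) +i* - sin (arg z).
  apply: (mulfI z0); rewrite divff // [X in _ = X * _]ez z1 mul1r.
  apply/eqP; rewrite eq_complex; apply/andP; split; apply/eqP.
    by rewrite -[RHS]/(_ - _) /= mulrN opprK -!expr2 cos2Dsin2.
  by rewrite -[RHS]/(_ + _) /= mulrN mulrC addNr.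
have nV : `|z^-1| = 1 by rewrite normfV z1 invr1.
have zV0 : z^-1 != 0 by rewrite invr_eq0.
have [api|anpi] := eqVneq (arg z) pi.
  rewrite (is_arg_inj zV0 (argP _) (s := arg z)) //.
  split; rewrite ?a1 // nV mul1r eV api sinpi oppr0 //.
rewrite (is_arg_inj zV0 (argP _) (s := - arg z)) ?normrN //.
split; last by rewrite nV mul1r eV cosN sinN.
by rewrite ltrN2 lerNl (ltW a1) andbT lt_neqAle anpi.
Qed.

End Argument.

Record graph (V : eqType) := Graph {
  adj :> rel V;
  adj_sym : symmetric adj;
  adj_irr : irreflexive adj }.

Section Complement.
Variables (V : eqType) (G : graph V).

Definition compl_adj : rel V := [rel x y | (x != y) && ~~ G x y].

Lemma compl_sym : symmetric compl_adj.
Proof. by move=> x y; rewrite /compl_adj /= eq_sym adj_sym. Qed.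

Lemma compl_irr : irreflexive compl_adj.
Proof. by move=> x; rewrite /compl_adj /= eqxx. Qed.

Definition compl : graph V := Graph compl_sym compl_irr.

End Complement.

(* The argument itself is rational, not a rational multiple of pi. *)
Definition C3_vertex (R : realType) : choiceType :=
  {z : R[i] | `[< `|z| = 1 /\ exists q : rat, arg z = ratr q >]}.

Section C3.
Variable R : realType.
Implicit Types z w : C3_vertex R.

Definition C3_adj : rel (C3_vertex R) :=
  [rel z w | (z != w) && (2 / 3 * pi < `|arg (val z / val w)|)].

Lemma C3_sym : symmetric C3_adj.
Proof.
move=> z w; rewrite /C3_adj /= eq_sym; congr (_ && (_ < _)).
have /asboolP[nz _] := valP z; have /asboolP[nw _] := valP w.
by rewrite -norm_argV ?invf_div // normrM normfV nz nw invr1 mulr1.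
Qed.

Lemma C3_irr : irreflexive C3_adj.
Proof. by move=> z; rewrite /C3_adj /= eqxx. Qed.

Definition C3 : graph (C3_vertex R) := Graph C3_sym C3_irr.

End C3.

(* A function from E(G) to Z_2: [label x y] is the value on the edge xy and
   is meaningless when x and y are not adjacent. *)
Record labelling (V : eqType) (G : graph V) := Labelling {
  label :> V -> V -> 'Z_2;
  label_sym : forall x y, G x y -> label x y = label y x }.

Section Balancing.
Variables (V : eqType) (G : graph V).

(* [c 0, ..., c (n - 1)] is a cyclic enumeration of the vertices of an induced
   cycle; [ordS] is the cyclic successor on 'I_n. *)
Definition induced_cycle (n : nat) (c : 'I_n -> V) : Prop :=
  [/\ (3 <= n)%N, injective c &
      forall i j, G (c i) (c j) = (j == ordS i) || (i == ordS j)].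

Definition cycle_label (s : labelling G) (n : nat) (c : 'I_n -> V) : 'Z_2 :=
  \sum_(i < n) s (c i) (c (ordS i)).

Definition anti_even_balancing (s : labelling G) : Prop :=
  forall (n : nat) (c : 'I_n -> V), induced_cycle c ->
    cycle_label s c = if n == 3%N then 0 else 1.

End Balancing.

Definition independent (T : finType) (G : graph T) (S : {set T}) : Prop :=
  {in S &, forall x y, ~~ G x y}.

Definition label_embedding (V W : eqType) (G : graph V) (H : graph W)
    (sG : labelling G) (sH : labelling H) (f : V -> W) : Prop :=
  [/\ injective f,
      forall x y, H (f x) (f y) = G x y &
      forall x y, G x y -> sH (f x) (f y) = sG x y].

(* Main.v *)
Require Import Defs.
From mathcomp Require Import all_boot all_order all_algebra.
From mathcomp Require Import all_classical all_reals all_analysis.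
From mathcomp Require Import complex zify ring lra.

(** Cut the circle into three arcs of length 2 pi / 3 and record for a vertex
    its arc [k] and its position [g] inside the arc. In the complement of C_3,
    vertices on the same arc are adjacent, and x is adjacent to y on the next
    arc exactly when g y < g x (equality is impossible since pi is irrational).
    The label of xy is 1 when the arcs differ, switched at a set of vertices
    that is dense with dense complement, so that every switching pattern can be
    realised by small perturbations.

    Conversely, let G carry a balancing labelling. If v has a non-neighbour,
    then the non-neighbours of v form one clique; after switching, the label
    towards that clique splits the remaining vertices into two further cliques,
    in such a way that all labels between distinct cliques are 1. Adjacency
    between the three cliques then prescribes which of two positions is the
    smaller one. A cyclic prescription would shorten to one of length 3 or 4,
    which is an independent triple, a triangle of odd label or an induced
    4-cycle of even label; hence the positions can be chosen. *)

Set Implicit Arguments.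
Unset Strict Implicit.
Unset Printing Implicit Defensive.

Import Order.TTheory GRing.Theory Num.Theory.

Local Open Scope ring_scope.

(** * Arrows between three cyclically ordered classes *)

Section CyclicThirds.
Variables (V : eqType) (G : graph V) (k : V -> option bool).

(* [None], [Some false], [Some true] name the three arcs in cyclic order. *)
Definition next_third (o : option bool) : option bool :=
  match o with
  | None => Some false
  | Some false => Some true
  | Some true => None
  end.

(* [arrow x y] asks that x lie before y, measured inside their arcs. *)
Definition arrow : rel V :=
  [rel x y | (k y == next_third (k x)) && ~~ G x y ||
             (k x == next_third (k y)) && G x y].

Lemma arrowE x y : arrow x y =
  (k y == next_third (k x)) && ~~ G x y || (k x == next_third (k y)) && G x y.
Proof. by []. Qed.

(** Of two different classes exactly one follows the other, so adjacency selects exactly one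
    direction. *)
Lemma arrowC x y : k x != k y -> arrow x y = ~~ arrow y x.
Proof.
rewrite /arrow /= (adj_sym G y x).
by case: (k x) (k y) => [[]|] [[]|] //= _; rewrite ?orbF ?negbK.
Qed.

Lemma arrow_neq x y : arrow x y -> k x != k y.
Proof. by rewrite /arrow /=; case: (k x) (k y) => [[]|] [[]|]. Qed.

Lemma arrow_asym x y : arrow x y -> ~~ arrow y x.
Proof. by move=> xy; rewrite -arrowC // arrow_neq. Qed.

Lemma arrowVarrow x y : k x != k y -> arrow x y || arrow y x.
Proof. by move=> /arrowC->; rewrite orNb. Qed.

End CyclicThirds.

(** * Induced cycles as numbered lists of vertices *)

Section CycleSums.
Variables (V : eqType) (G : graph V) (s : labelling G).

Lemma cycle_label_inord m (c : 'I_m.+1 -> V) :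
  cycle_label s c =
  \sum_(0 <= i < m.+1) s (c (inord i)) (c (inord (i.+1 %% m.+1))).
Proof.
rewrite big_mkord; apply: eq_bigr => i _; rewrite inord_val.
by congr (s _ (c _)); apply: val_inj; rewrite /= inordK // ltn_pmod.
Qed.

Lemma induced_cycle_adj m (c : 'I_m.+1 -> V) : induced_cycle G c ->
  forall i j, (i < m.+1)%N -> (j < m.+1)%N ->
  G (c (inord i)) (c (inord j)) =
    (j == i.+1 %% m.+1)%N || (i == j.+1 %% m.+1)%N.
Proof. by move=> [_ _ h] i j li lj; rewrite h -!val_eqE /= !inordK. Qed.

Lemma induced_cycle_eq m (c : 'I_m.+1 -> V) : induced_cycle G c ->
  forall i j, (i < m.+1)%N -> (j < m.+1)%N ->
  (c (inord i) == c (inord j)) = (i == j).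
Proof. by move=> [_ h _] i j li lj; rewrite inj_eq // -val_eqE /= !inordK. Qed.

Lemma anti_even_balancing_seq (x : V) (l : seq V) :
  anti_even_balancing s -> uniq l -> (3 <= size l)%N ->
  (forall i j, (i < size l)%N -> (j < size l)%N ->
    G (nth x l i) (nth x l j) =
      (j == i.+1 %% size l)%N || (i == j.+1 %% size l)%N) ->
  \sum_(0 <= i < size l) s (nth x l i) (nth x l (i.+1 %% size l)) =
  if size l == 3%N then 0 else 1.
Proof.
move=> bal ul l3 adjl; rewrite big_mkord.
rewrite -(bal _ (fun i : 'I_(size l) => nth x l i)) //; split=> //.
  by move=> i j /eqP; rewrite nth_uniq // => /eqP /val_inj.
by move=> i j; rewrite adjl // -!val_eqE.
Qed.

End CycleSums.

(** * Balance on short cycles, and switching *)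

Section Balanced.
Variables (V : eqType) (G : graph V).
Implicit Types l : V -> V -> bool.

(** Lengths stop at 5 since a longer induced cycle contains three pairwise non-adjacent vertices. *)
Record balanced l : Prop := Balanced {
  balanced_sym : forall x y, G x y -> l x y = l y x;
  balanced3 : forall x y z, G x y -> G y z -> G x z ->
    l x y (+) l y z = l x z;
  balanced4 : forall x y z t, G x y -> G y z -> G z t -> G x t ->
    x != z -> ~~ G x z -> y != t -> ~~ G y t ->
    l x y (+) l y z (+) l z t (+) l x t;
  balanced5 : forall x y z t u, G x y -> G y z -> G z t -> G t u -> G x u ->
    uniq [:: x; y; z; t; u] ->
    ~~ G x z -> ~~ G x t -> ~~ G y t -> ~~ G y u -> ~~ G z u ->
    l x y (+) l y z (+) l z t (+) l t u (+) l x u }.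

(** Every vertex of a cycle lies on two of its edges, so its switching value cancels. *)
Lemma balanced_switch l (t : V -> bool) : balanced l ->
  balanced (fun x y => l x y (+) (t x (+) t y)).
Proof.
case=> lC l3 l4 l5; split=> [x y xy|x y z xy yz xz|x y z w|x y z w u].
- by rewrite lC // (addbC (t x)).
- by rewrite -(l3 x y z) //;
  case: (l x y) (l y z) (t x) (t y) (t z) => [] [] [] [] [].
- move=> h1 h2 h3 h4 h5 h6 h7 h8; move: (l4 _ _ _ _ h1 h2 h3 h4 h5 h6 h7 h8).
  by case: (l x y) (l y z) (l z w) (l x w) (t x) (t y) (t z) (t w)
    => [] [] [] [] [] [] [] [].
- move=> h1 h2 h3 h4 h5 h6 h7 h8 h9 h10 h11.
  move: (l5 _ _ _ _ _ h1 h2 h3 h4 h5 h6 h7 h8 h9 h10 h11).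
  by case: (l x y) (l y z) (l z w) (l w u) (l x u) (t x) (t y) (t z) (t w) (t u)
    => [] [] [] [] [] [] [] [] [] [].
Qed.

Lemma Z2_bool (a : 'Z_2) : a = (a != 0 : bool)%:R.
Proof. by case: a => [[|[|//]] i]; apply: val_inj. Qed.

Lemma anti_even_balancing_balanced (s : labelling G) :
  anti_even_balancing s -> balanced (fun x y => s x y != 0).
Proof.
move=> bal.
have sC x y : G x y -> s x y = s y x := label_sym s (x := x) (y := y).
have nG x y : G x y -> x != y by apply: contraTneq => ->; rewrite adj_irr.
split=> [x y /sC-> //|x y z xy yz xz|x y z t xy yz zt xt nxz xz nyt yt|
         x y z t u xy yz zt tu xu ul xz xt yt yu zu].
- have ul : uniq [:: x; y; z] by rewrite /= !inE !negb_or !nG.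
  have := @anti_even_balancing_seq _ _ s x [:: x; y; z] bal ul isT.
  rewrite unlock /= => sumE; move: sumE => /(_ _)/wrap[].
    move=> [|[|[|//]]] [|[|[|//]]] //= _ _; rewrite ?adj_irr //;
      by [apply: negbTE | rewrite adj_sym | rewrite adj_sym; apply: negbTE].
  rewrite -(sC x z) // (Z2_bool (s x y)) (Z2_bool (s y z)) (Z2_bool (s x z)).
  by case: (s x y != 0) (s y z != 0) (s x z != 0) => [] [] [] /eqP.
- have ul : uniq [:: x; y; z; t] by rewrite /= !inE !negb_or nxz nyt !nG.
  have := @anti_even_balancing_seq _ _ s x [:: x; y; z; t] bal ul isT.
  rewrite unlock /= => sumE; move: sumE => /(_ _)/wrap[].
    move=> [|[|[|[|//]]]] [|[|[|[|//]]]] //= _ _; rewrite ?adj_irr //;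
      by [apply: negbTE | rewrite adj_sym | rewrite adj_sym; apply: negbTE].
  rewrite -(sC x t) // (Z2_bool (s x y)) (Z2_bool (s y z)) (Z2_bool (s z t)).
  rewrite (Z2_bool (s x t)).
  by case: (s x y != 0) (s y z != 0) (s z t != 0) (s x t != 0)
    => [] [] [] [] /eqP.
- have := @anti_even_balancing_seq _ _ s x [:: x; y; z; t; u] bal ul isT.
  rewrite unlock /= => sumE; move: sumE => /(_ _)/wrap[].
    move=> [|[|[|[|[|//]]]]] [|[|[|[|[|//]]]]] //= _ _; rewrite ?adj_irr //;
      by [apply: negbTE | rewrite adj_sym | rewrite adj_sym; apply: negbTE].
  rewrite -(sC x u) // (Z2_bool (s x y)) (Z2_bool (s y z)) (Z2_bool (s z t)).
  rewrite (Z2_bool (s t u)) (Z2_bool (s x u)).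
  by case: (s x y != 0) (s y z != 0) (s z t != 0) (s t u != 0) (s x u != 0)
    => [] [] [] [] [] /eqP.
Qed.

End Balanced.

(** * The labelling defined by three cliques and a switching *)

Section ThirdsLabelling.
Variables (V : eqType) (G : graph V) (k : V -> option bool) (t : V -> bool).

Definition thirds_label (x y : V) : 'Z_2 :=
  ((k x != k y) (+) (t x (+) t y) : bool)%:R.

Lemma thirds_labelC x y : G x y -> thirds_label x y = thirds_label y x.
Proof. by rewrite /thirds_label eq_sym (addbC (t x)). Qed.

Definition thirds_labelling : labelling G := Labelling thirds_labelC.

(** The map [g] excludes directed cycles of arrows. The switching cancels along a cycle, so only the
    parity of the number of edges between different classes matters. *)
Lemma thirds_anti_even_balancing d (I : porderType d) (g : V -> I) :
  (forall x y, x != y -> k x = k y -> G x y) ->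
  (forall x y, arrow G k x y -> (g x < g y)%O) ->
  anti_even_balancing thirds_labelling.
Proof.
move=> clq arrP.
have cyc3 x y z : arrow G k x y -> arrow G k y z -> arrow G k z x -> False.
  move=> /arrP xy /arrP yz /arrP zx.
  by have := lt_trans (lt_trans xy yz) zx; rewrite ltxx.
have cyc4 x y z w : arrow G k x y -> arrow G k y z -> arrow G k z w ->
    arrow G k w x -> False.
  move=> /arrP xy /arrP yz /arrP zw /arrP wx.
  by have := lt_trans (lt_trans xy yz) (lt_trans zw wx); rewrite ltxx.
have nclq x y : x != y -> ~~ G x y -> k x != k y.
  by move=> nxy; apply: contraNneq => /(clq _ _ nxy).
(* Three vertices in three different classes that are all adjacent, or all non-adjacent, would carry
   a directed triangle of arrows. *)
have G3 x y z : G x y -> G y z -> G x z ->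
    [|| k x == k y, k y == k z | k x == k z].
  move=> xy yz xz; apply/negPn/negP.
  move: (cyc3 x y z) (cyc3 x z y).
  rewrite /arrow /= !(adj_sym G z) (adj_sym G y x) xy yz xz.
  by case: (k x) (k y) (k z) => [[]|] [[]|] [[]|] //= h1 h2; tauto.
have I3 x y z : x != y -> y != z -> x != z -> ~~ G x y -> ~~ G y z -> G x z.
  move=> nxy nyz nxz xy yz; apply/negPn/negP => xz.
  move: (nclq _ _ nxy xy) (nclq _ _ nyz yz) (nclq _ _ nxz xz).
  move: (cyc3 x y z) (cyc3 x z y).
  rewrite /arrow /= !(adj_sym G z) (adj_sym G y x) xy yz xz.
  by case: (k x) (k y) (k z) => [[]|] [[]|] [[]|] //= h1 h2; tauto.
case=> [|[|[|n]]] c indc; try by case: indc.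
have adjc := induced_cycle_adj indc; have eqc := induced_cycle_eq indc.
rewrite cycle_label_inord.
case: n c indc adjc eqc => [|[|[|n]]] c indc adjc eqc.
(* Length 3: two vertices share a class, so 0 or 2 edges cross between classes. *)
- rewrite unlock /= /thirds_label.
  move: (adjc 0 1 isT isT) (adjc 1 2 isT isT) (adjc 0 2 isT isT) => /G3 h.
  move=> /h{}h /h.
  set x := c _; set y := c _; set z := c _.
  by case: (k x) (k y) (k z) (t x) (t y) (t z)
    => [[]|] [[]|] [[]|] [] [] [] // _; apply/eqP.
(* Length 4: opposite vertices lie in different classes, so 2 or 3 edges cross; 2 would give a
   directed 4-cycle of arrows. *)
- rewrite unlock /= /thirds_label.
  have := nclq _ _ (negbT (eqc 0 2 isT isT)) (negbT (adjc 0 2 isT isT)).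
  have := nclq _ _ (negbT (eqc 1 3 isT isT)) (negbT (adjc 1 3 isT isT)).
  move: (adjc 0 2 isT isT) (adjc 1 3 isT isT).
  move: (adjc 0 1 isT isT) (adjc 1 2 isT isT) (adjc 2 3 isT isT)
    (adjc 0 3 isT isT).
  rewrite /=.
  set x := c _; set y := c _; set z := c _; set w := c _.
  move=> xy yz zw xw xz yw.
  move: (cyc4 x y z w) (cyc4 x w z y) (cyc4 x y w z).
  move: (cyc4 x z y w) (cyc4 x z w y) (cyc4 x w y z).
  rewrite /arrow /= !(adj_sym G z) !(adj_sym G w) (adj_sym G y x).
  rewrite xy yz zw xw xz yw.
  case: (k x) (k y) (k z) (k w) => [[]|] [[]|] [[]|] [[]|] //= *;
   by [exfalso; tauto
      |case: (t x) (t y) (t z) (t w) => [] [] [] []; apply/eqP].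
(* Length 5: non-adjacent vertices lie in different classes, so the classes are two consecutive
   pairs and a single vertex, and 3 edges cross. *)
- rewrite unlock /= /thirds_label.
  have := nclq _ _ (negbT (eqc 0 2 isT isT)) (negbT (adjc 0 2 isT isT)).
  have := nclq _ _ (negbT (eqc 1 3 isT isT)) (negbT (adjc 1 3 isT isT)).
  have := nclq _ _ (negbT (eqc 2 4 isT isT)) (negbT (adjc 2 4 isT isT)).
  have := nclq _ _ (negbT (eqc 0 3 isT isT)) (negbT (adjc 0 3 isT isT)).
  have := nclq _ _ (negbT (eqc 1 4 isT isT)) (negbT (adjc 1 4 isT isT)).
  set x := c _; set y := c _; set z := c _; set w := c _; set u := c _.
  case: (k x) (k y) (k z) (k w) (k u) => [[]|] [[]|] [[]|] [[]|] [[]|] //= *;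
  by case: (t x) (t y) (t z) (t w) (t u) => [] [] [] [] []; apply/eqP.
(* Length at least 6: the vertices numbered 0, 2, 4 are independent. *)
- have := I3 _ _ _ (negbT (eqc 0 2 isT isT)) (negbT (eqc 2 4 isT isT))
    (negbT (eqc 0 4 isT isT)).
  by rewrite !adjc //= => /(_ isT isT).
Qed.

End ThirdsLabelling.

(** * From the absence of short directed cycles to a rank *)

Section Ranking.
Variables (T : finType) (G : graph T) (k : T -> option bool).
Hypothesis no3 : forall x y z,
  arrow G k x y -> arrow G k y z -> ~~ arrow G k z x.
Hypothesis no4 : forall x y z w, k x = k z -> k y = k w ->
  arrow G k x y -> arrow G k y z -> arrow G k z w -> ~~ arrow G k w x.
Local Notation arr := (arrow G k).

(** If [y] and [w] lie in different classes, the arrow between them closes a directed triangle with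
    [x] or with [z]. *)
Lemma arrow_no4 x y z w : k x = k z ->
  arr x y -> arr y z -> arr z w -> ~~ arr w x.
Proof.
move=> xz xy yz zw; have [yw|/(arrowVarrow G)/orP[yw|wy]] := eqVneq (k y) (k w).
- exact: no4 xz yw xy yz zw.
- exact: no3 xy yw.
- by apply/negP => wx; have := no3 yz zw; rewrite wy.
Qed.

(* In the absence of cycles of length 3 and 4, the transitive closure of
   [arr] is reached after two steps. *)
Definition before : rel T :=
  [rel x y | arr x y || (k x == k y) && [exists z, arr x z && arr z y]].

Lemma before_irr x : before x x = false.
Proof.
apply/negbTE; rewrite /before /= eqxx negb_or; apply/andP; split.
  by apply/negP => /[dup] /arrow_asym/negP.
by apply/existsPn => z; apply/negP => /andP[/arrow_asym/negP].
Qed.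

(** The composed path has two, three or four arrows. Between ends in different classes a backward
    arrow would close a directed triangle or 4-cycle, so there is a forward shortcut; four arrows
    become two by shortcutting the first three. *)
Lemma before_trans : transitive before.
Proof.
move=> y x z /orP[xy|/andP[/eqP kxy /existsP[w /andP[xw wy]]]]
  /orP[yz|/andP[/eqP kyz /existsP[u /andP[yu uz]]]]; rewrite /before /=.
- have [kxz|/(arrowC G)->] := eqVneq (k x) (k z).
    by apply/orP; right; apply/existsP; exists y; rewrite xy.
  by rewrite (no3 xy yz).
- have kxz : k x != k z by rewrite -kyz (arrow_neq xy).
  rewrite (arrowC G kxz); apply/orP; left; apply/negP => zx.
  by have := arrow_no4 kyz yu uz zx; rewrite xy.
- by rewrite arrowC ?(arrow_no4 kxy xw wy yz) // kxy (arrow_neq yz).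
- rewrite kxy kyz eqxx /=; apply/orP; right; apply/existsP; exists u.
  by rewrite uz andbT arrowC ?(arrow_no4 kxy xw wy yu) // kxy (arrow_neq yu).
Qed.

Definition rank (x : T) : nat := #|[set y | before y x]|.

Lemma arrow_rank x y : arr x y -> (rank x < rank y)%N.
Proof.
move=> xy; have bxy : before x y by rewrite /before /= xy.
apply: proper_card; apply/properP; split.
  by apply/fintype.subsetP => z; rewrite !inE => /before_trans; apply.
by exists x; rewrite inE // before_irr.
Qed.

End Ranking.

(** * Three cliques around a vertex with a non-neighbour, after switching *)

Section Tripartition.
Variables (T : finType) (G : graph T) (l : T -> T -> bool) (v m0 : T).
Hypothesis bal : balanced G l.
Hypothesis alpha : forall x y z, x != y -> y != z -> x != z ->
  [|| G x y, G y z | G x z].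
Local Notation far := (fun x => (x != v) && ~~ G v x).
Hypothesis far_m0 : far m0.
Hypothesis l_v : forall x, G v x -> l v x = false.
Hypothesis l_m0 : forall m, far m -> G m0 m -> l m0 m = false.

Let adj_neq x y : G x y -> x != y.
Proof. by apply: contraTneq => ->; rewrite adj_irr. Qed.

Let far_neq x m : G v x -> far m -> x != m.
Proof. by move=> vx; apply: contraTneq => <-; rewrite vx andbF. Qed.

Let far_adj m m' : far m -> far m' -> m != m' -> G m m'.
Proof.
move=> /andP[mv vm] /andP[m'v vm'] mm'.
have := @alpha v m m'; rewrite (negbTE vm) (negbTE vm') /= orbF !(eq_sym v).
by move=> ->.
Qed.

(** In the triangle with [m0] the other two edges have label 0. *)
Let far_l m m' : far m -> far m' -> G m m' -> l m m' = false.
Proof.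
move=> fm fm' mm'; have [e|m0m] := eqVneq m0 m; first by rewrite -e l_m0 ?e.
have Gm := far_adj far_m0 fm m0m.
have [e|m0m'] := eqVneq m0 m'.
  by rewrite (balanced_sym bal) -e ?l_m0 // e.
have Gm' := far_adj far_m0 fm' m0m'.
rewrite -(balanced3 bal (y := m0)) // 1?adj_sym //.
by rewrite -(balanced_sym bal) ?l_m0.
Qed.

Let near_l x y : G v x -> G v y -> G x y -> l x y = false.
Proof.
by move=> vx vy xy; have := balanced3 bal vx xy vy; rewrite !l_v.
Qed.

Let far_unif x m m' : far m -> far m' -> G x m -> G x m' -> l x m = l x m'.
Proof.
move=> fm fm' xm xm'; have [->//|mm'] := eqVneq m m'.
have Gm := far_adj fm fm' mm'.
by rewrite -(balanced3 bal xm Gm xm') (far_l fm fm' Gm) addbF.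
Qed.

(* Since all far vertices are joined by edges of label 0, a vertex [sees] at
   most one value. *)
Definition sees (e : bool) (x : T) :=
  [exists m, [&& far m, G x m & l x m == e]].

Let seesP e x m : sees e x -> far m -> G x m -> l x m = e.
Proof.
by move=> /existsP[m' /and3P[fm' xm' /eqP<-]] fm xm; exact: far_unif.
Qed.

Let sees_adj x m : far m -> G x m -> sees (l x m) x.
Proof. by move=> fm xm; apply/existsP; exists m; rewrite fm xm /=. Qed.

(** If [x] and [y] were not adjacent, a common far neighbour would give an induced 4-cycle through
    [v], and two separate far neighbours an induced 5-cycle. Its label is [e] added twice, hence
    0. *)
Let sees_clique e x y : G v x -> G v y -> sees e x -> sees e y ->
  x != y -> G x y.
Proof.
move=> vx vy ex ey nxy; apply/negPn/negP => xy.
have no_common m : far m -> G x m -> G y m -> False.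
  move=> fm xm ym; have /andP[mv vm] := fm.
  have := balanced4 bal vx xm _ _ _ vm nxy xy.
  rewrite eq_sym mv (adj_sym G m) ym vy => /(_ isT isT isT).
  rewrite (balanced_sym bal (x := m)) 1?adj_sym // !l_v //.
  by rewrite (seesP ex fm xm) (seesP ey fm ym); case: e {ex ey}.
have /existsP[m /and3P[fm xm _]] := ex.
have /existsP[m' /and3P[fm' ym' _]] := ey.
have nym : ~~ G y m by apply/negP; exact: no_common fm xm.
have nxm' : ~~ G x m' by apply/negP => /no_common; apply.
have mm' : m != m' by apply: contraNneq nym => ->.
have Gmm' := far_adj fm fm' mm'.
have /andP[mv vm] := fm; have /andP[m'v vm'] := fm'.
have ul : uniq [:: v; x; m; m'; y].
  rewrite /= !inE !negb_or !(adj_neq vx, adj_neq vy, mm', nxy) /=.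
  rewrite !(eq_sym v) mv m'v (eq_sym m y) (eq_sym m' y).
  by rewrite (far_neq vx fm) (far_neq vx fm') (far_neq vy fm) (far_neq vy fm').
have m'y : G m' y by rewrite adj_sym.
have := balanced5 bal vx xm Gmm' m'y vy ul vm vm' nxm' xy.
rewrite (adj_sym G m) nym => /(_ isT).
rewrite !l_v // (far_l fm fm' Gmm') (balanced_sym bal m'y).
rewrite (seesP ex) // (seesP ey) //.
by case: e {ex ey}.
Qed.

Let sees_nonadj x y : G v x -> G v y -> x != y -> ~~ G x y ->
  [|| sees false x, sees true x, sees false y | sees true y].
Proof.
move=> vx vy nxy xy.
have := alpha nxy (far_neq vy far_m0) (far_neq vx far_m0).
by rewrite (negbTE xy) /= => /orP[] /(sees_adj far_m0); case: (l _ _) => ->;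
  rewrite ?orbT.
Qed.

(** If [z] is not adjacent to [m0], the absence of independent triples makes [p], [q], [m0] a
    triangle, and its only edge of label 1 is the one from [q] to [m0]. *)
Let sees_both z p q : G v z -> G v p -> G v q -> z != p -> z != q ->
  ~~ G z p -> ~~ G z q -> sees false p -> sees true q ->
  sees false z || sees true z.
Proof.
move=> vz vp vq nzp nzq zp zq sp sq.
have [zm|zm] := boolP (G z m0).
  by have := sees_adj far_m0 zm; case: (l _ _) => ->; rewrite ?orbT.
have pm : G p m0.
  have := alpha nzp (far_neq vp far_m0) (far_neq vz far_m0).
  by rewrite (negbTE zp) (negbTE zm) /= orbF.
have qm : G q m0.
  have := alpha nzq (far_neq vq far_m0) (far_neq vz far_m0).
  by rewrite (negbTE zq) (negbTE zm) /= orbF.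
have lp := seesP sp far_m0 pm; have lq := seesP sq far_m0 qm.
have pq : G p q.
  have npq : p != q by apply/eqP => e; move: lp; rewrite e lq.
  by have := alpha nzp npq nzq; rewrite (negbTE zp) (negbTE zq) /= orbF.
by have := balanced3 bal pq qm pm; rewrite lp lq near_l.
Qed.

(* A vertex that sees nothing joins the side opposite to its non-neighbours. *)
Definition side (x : T) := G v x &&
  (sees false x || [exists b, [&& G v b, x != b, ~~ G x b & sees true b]]).

(** Two vertices that see 0 are adjacent by [sees_clique]. In the other cases, non-adjacency would
    force, by [sees_both] or [sees_nonadj], a vertex not seeing 0 to see 1, but it has a
    non-neighbour that sees 1. *)
Let side_clique x y : side x -> side y -> x != y -> G x y.
Proof.
have aux a b : side b -> G v a -> sees false a -> a != b -> G a b.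
  move=> /andP[vb sb] va sa nab; apply/negPn/negP => ab.
  have [sb'|nsb] := boolP (sees false b).
    by move: ab; rewrite (sees_clique va vb sa sb' nab).
  move: sb; rewrite (negbTE nsb) /= => /existsP[c /and4P[vc nbc bc sc]].
  have := sees_both vb va vc _ nbc _ bc sa sc.
  rewrite eq_sym nab adj_sym ab (negbTE nsb) => /(_ isT isT) /= sb.
  by move: bc; rewrite (sees_clique vb vc sb sc nbc).
move=> sx sy nxy; have [/andP[vx hx] /andP[vy hy]] := (sx, sy).
have [sfx|nsx] := boolP (sees false x); first exact: aux.
have [sfy|nsy] := boolP (sees false y); first by rewrite adj_sym aux // eq_sym.
move: hx hy; rewrite (negbTE nsx) (negbTE nsy) /=.
move=> /existsP[b /and4P[vb nxb xb sb]] /existsP[c /and4P[vc nyc yc sc]].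
apply/negPn/negP => xy; have := sees_nonadj vx vy nxy xy.
rewrite (negbTE nsx) (negbTE nsy) /= => /orP[] s.
  by move: xb; rewrite (sees_clique vx vb s sb nxb).
by move: yc; rewrite (sees_clique vy vc s sc nyc).
Qed.

(** Of two non-adjacent vertices one would see 1, which puts the other on the side. *)
Let nside_clique x y : G v x -> G v y -> ~~ side x -> ~~ side y ->
  x != y -> G x y.
Proof.
move=> vx vy; rewrite /side vx vy /= !negb_or.
move=> /andP[nsx /existsPn hx] /andP[nsy /existsPn hy] nxy.
apply/negPn/negP => xy; have := sees_nonadj vx vy nxy xy.
rewrite (negbTE nsx) (negbTE nsy) /= => /orP[] s.
  by have := hy x; rewrite vx eq_sym nxy adj_sym xy s.
by have := hx y; rewrite vy nxy xy s.
Qed.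

Let side_l x m : G v x -> far m -> G x m -> l x m = ~~ side x.
Proof.
move=> vx fm xm; have sx := sees_adj fm xm.
rewrite /side vx /=; case: (boolP (sees false x)) => [s|].
  exact: seesP s fm xm.
case: (l x m) sx => [sx _|->//]; apply/esym/negP => /existsP[b].
by move=> /and4P[vb nxb /negP xb sb]; apply: xb; exact: sees_clique sx sb nxb.
Qed.

(** The vertex [v] itself falls into [Some true]. *)
Definition third_of (x : T) : option bool :=
  if far x then Some false else if side x then None else Some true.

Lemma third_of_clique x y : x != y -> third_of x = third_of y -> G x y.
Proof.
move=> nxy; rewrite /third_of.
have [fx|nfx] := boolP (far x); have [fy|nfy] := boolP (far y).
- by move=> _; exact: far_adj.
- by case: ifP.
- by case: ifP.
have [sx|sx] := boolP (side x); have [sy|sy] := boolP (side y) => // _.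
  exact: side_clique.
move: nfx nfy; rewrite !negb_and !negbK.
move=> /orP[/eqP xv|vx] /orP[/eqP yv|vy].
- by rewrite xv yv eqxx in nxy.
- by rewrite xv.
- by rewrite yv adj_sym.
- exact: nside_clique.
Qed.

(** Only edges between a far and a non-far vertex can have label 1, and they do exactly off the
    side; switching at the side moves this to all edges between different classes. *)
Lemma third_of_label x y : G x y ->
  l x y = (third_of x != third_of y) (+) (side x (+) side y).
Proof.
have nfar a : far a = false -> (a == v) || G v a.
  by move/negbT; rewrite negb_and !negbK.
have sfar a : far a -> side a = false.
  by move=> /andP[_ /negbTE va]; rewrite /side va.
have sv : side v = false by rewrite /side adj_irr.
have aux a b : far b -> far a = false -> G a b ->
    l a b = (third_of a != third_of b) (+) (side a (+) side b).
  move=> fb fa ab; rewrite /third_of fb fa (sfar b) // addbF.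
  have /orP[/eqP av|va] := nfar _ fa.
    by move: fb; rewrite -av ab andbF.
  by rewrite (side_l va fb ab); case: (side a).
move=> xy; case fx: (far x); case fy: (far y).
- by rewrite far_l // /third_of fx fy !sfar.
- rewrite (balanced_sym bal xy) aux // 1?adj_sym //.
  by rewrite eq_sym (addbC (side x)).
- exact: aux.
have -> : l x y = false.
  have /orP[/eqP xv|vx] := nfar _ fx; first by rewrite xv in xy *; exact: l_v.
  have /orP[/eqP yv|vy] := nfar _ fy; last exact: near_l.
  by rewrite (balanced_sym bal xy); rewrite yv in xy *; rewrite l_v // adj_sym.
by rewrite /third_of fx fy; case: (side x) (side y) => [] [].
Qed.

End Tripartition.

(** * Classes and positions for a finite balanced graph *)

Lemma balanced_thirds (T : finType) (G : graph T) (l : T -> T -> bool) :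
  balanced G l ->
  (forall x y z, x != y -> y != z -> x != z -> [|| G x y, G y z | G x z]) ->
  exists k : T -> option bool, exists t : T -> bool,
    (forall x y, x != y -> k x = k y -> G x y) /\
    (forall x y, G x y -> l x y = (k x != k y) (+) (t x (+) t y)).
Proof.
move=> bal alpha.
have [/existsP[v /existsP[m0 vm]]|complete] :=
  boolP [exists v, exists m, (m != v) && ~~ G v m].
  pose far x := (x != v) && ~~ G v x.
  (* Switching at [t] makes the labels 0 on the edges at [v] and on those from [m0] to the other
     non-neighbours of [v]. *)
  pose t x := if x == v then false else
    if far x then (x != m0) && l m0 x else l v x.
  pose l' x y := l x y (+) (t x (+) t y).
  have bal' : balanced G l' := balanced_switch t bal.
  have lv x : G v x -> l' v x = false.
    move=> vx; rewrite /l' /t eqxx /far vx andbF.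
    by case: eqP vx => [->|_ _]; rewrite ?adj_irr ?addbb.
  have lm m : far m -> G m0 m -> l' m0 m = false.
    move=> fm Gm; have /andP[mv _] := fm; have /andP[m0v _] := vm.
    have fm0 : far m0 by [].
    rewrite /l' /t (negbTE m0v) (negbTE mv) fm fm0 eqxx /=.
    case: eqP Gm => [->|_ _]; first by rewrite adj_irr.
    by rewrite addbb.
  exists (third_of G l' v), (fun x => t x (+) side G l' v x); split.
    exact: third_of_clique bal' alpha vm lv lm.
  move=> x y xy; have := third_of_label bal' alpha vm lv lm xy; rewrite /l'.
  case: (l x y) (_ != _) (t x) (t y) (side _ _ _ x) (side _ _ _ y)
    => [] [] [] [] [] [] //=.
have Gxy x y : x != y -> G x y.
  move=> nxy; have /existsPn/(_ x)/existsPn/(_ y) := complete.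
  by rewrite eq_sym nxy negbK.
have [x0 _|T0] := pickP (mem T); last first.
  by exists (fun=> None), xpred0; split=> x; have := T0 x; rewrite inE.
(* In a complete graph one class is enough: triangles through [x0] show that the label is a pure
   switching. *)
exists (fun=> None), (fun x => (x != x0) && l x0 x).
split=> [x y /Gxy//|x y xy].
rewrite eqxx /=; have [x_x0|nx] := eqVneq x x0.
  by rewrite x_x0 in xy *; case: eqP xy => [->|//]; rewrite adj_irr.
have [y_x0|ny] /= := eqVneq y x0.
  by rewrite addbF (balanced_sym bal) // y_x0.
have xx0 := Gxy _ _ nx; have x0y : G x0 y by rewrite Gxy // eq_sym.
by rewrite -(balanced3 bal xx0 x0y xy) (balanced_sym bal xx0).
Qed.

Lemma thirds_rank (T : finType) (G : graph T) (l : T -> T -> bool)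
    (k : T -> option bool) (t : T -> bool) :
  balanced G l ->
  (forall x y z, x != y -> y != z -> x != z -> [|| G x y, G y z | G x z]) ->
  (forall x y, x != y -> k x = k y -> G x y) ->
  (forall x y, G x y -> l x y = (k x != k y) (+) (t x (+) t y)) ->
  exists g : T -> nat, forall x y, arrow G k x y -> (g x < g y)%N.
Proof.
move=> bal alpha clq lE; exists (rank G k) => x y; apply: arrow_rank => {x y}.
  move=> x y z xy yz; apply/negP => zx.
  (* The three classes differ, so the pairs are all non-adjacent, against [alpha], or all adjacent,
     giving a triangle of label 1. *)
  have nk := (arrow_neq xy, arrow_neq yz, arrow_neq zx).
  have neqk a b : k a != k b -> a != b by apply: contraNneq => ->.
  have nn := (neqk _ _ nk.1.1, neqk _ _ nk.1.2, neqk _ _ nk.2).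
  have := alpha x y z nn.1.1 nn.1.2; rewrite eq_sym nn.2 => /(_ isT).
  have := @balanced3 _ _ _ bal x y z.
  move: (lE x y) (lE y z) (lE x z) xy yz zx.
  rewrite /arrow /= (adj_sym G z x).
  case: (k x) (k y) (k z) => [[]|] [[]|] [[]|] //=;
  case: (G x y) (G y z) (G x z) => [] [] [] //=;
  move=> /(_ isT)-> /(_ isT)-> /(_ isT)-> _ _ _ /(_ isT isT isT) + _;
  by case: (t x) (t y) (t z) => [] [] [].
move=> x y z w kxz kyw xy yz zw; apply/negP => wx.
have kxy := arrow_neq xy; have nxz : x != z.
  by apply: contraTneq yz => <-; rewrite arrow_asym.
have nyw : y != w.
  by apply: contraTneq zw => <-; rewrite arrow_asym.
have := clq x z nxz kxz; have := clq y w nyw kyw.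
(* The 4-cycle [a], [d], [b], [c] is induced. Two opposite edges stay inside a class and the other
   two join the same two classes, so its label is 0. *)
have aux a b c d : k a = k c -> k b = k d -> G a c -> G b d ->
    a != b -> c != d -> ~~ G a b -> ~~ G c d -> G a d -> G b c -> False.
  move=> kac kbd ac bd nab ncd ab cd ad bc.
  have db : G d b by rewrite adj_sym.
  have := balanced4 bal ad db bc ac nab ab _ _.
  rewrite (eq_sym d) ncd (adj_sym G d) cd => /(_ isT isT).
  rewrite !lE // -kac -kbd (eq_sym (k b)) !eqxx.
  by case: (_ == _) (t a) (t b) (t c) (t d) => [] [] [] [] [].
have neqk a b : k a != k b -> a != b by apply: contraNneq => ->.
have nn := (neqk _ _ (arrow_neq xy), neqk _ _ (arrow_neq yz),
  neqk _ _ (arrow_neq zw), neqk _ _ (arrow_neq wx)).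
move=> yw xz; move: xy yz zw wx; rewrite /arrow /= -kxz -kyw.
have [kyx|kyx] := eqVneq (k y) (next_third (k x)).
  have -> : (k x == next_third (k y)) = false.
    by rewrite kyx; case: (k x) => [[]|].
  rewrite !orbF /= => xy yz zw wx.
  by apply: (aux x y z w); rewrite // ?nn // adj_sym.
rewrite /= !orbF => /andP[_ xy] /andP[_ yz] /andP[_ zw] /andP[_ wx].
by apply: (aux y z w x); rewrite // ?nn // adj_sym.
Qed.

(** * Adjacency and arcs in terms of angles *)

Section CircleVertices.
Variable R : realType.
Implicit Types (z w : C3_vertex R) (x y : R).

Definition angle z : R := arg (val z).

Lemma norm_polar x : `|cos x +i* sin x|%C = 1 :> R[i].
Proof. by rewrite normc_def /= cos2Dsin2 sqrtr1. Qed.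

Lemma arg_polar x : - pi < x <= pi -> arg (cos x +i* sin x)%C = x.
Proof.
move=> hx; apply: is_arg_inj (argP _) _.
  by rewrite -normr_eq0 norm_polar oner_eq0.
by split; rewrite // norm_polar mul1r.
Qed.

Lemma val_polar z : val z = (cos (angle z) +i* sin (angle z))%C.
Proof.
have /asboolP[nz _] := valP z; have [_] := argP (val z).
by rewrite nz mul1r.
Qed.

Lemma angle_rat z : exists q : rat, angle z = ratr q.
Proof. by have /asboolP[] := valP z. Qed.

Lemma pi_neq_rat (q : rat) : ratr q != pi :> R.
Proof.
apply/eqP => e; apply: (@pi_irrationnal R).
by exists q.
Qed.

Lemma pi_mul_neq_rat (p q : rat) : p != 0 -> ratr q != ratr p * pi :> R.
Proof.
move=> p0; apply/eqP => e; have /eqP := pi_neq_rat (q / p); apply.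
by rewrite rmorphM /= e fmorphV /= mulrC mulKf // fmorph_eq0.
Qed.

(** The value [pi] is excluded because the angle is rational. *)
Lemma angle_range z : - pi < angle z < pi.
Proof.
have [/andP[h1 h2] _] := argP (val z); rewrite [X in X && _]h1 /=.
have [q e] := angle_rat z.
by rewrite lt_neqAle h2 andbT e pi_neq_rat.
Qed.

Lemma arg_div z w : `|arg (val z / val w)| =
  if `|angle z - angle w| <= pi then `|angle z - angle w|
  else 2 * pi - `|angle z - angle w|.
Proof.
set d := angle z - angle w.
have -> : val z / val w = (cos d +i* sin d)%C.
  have /asboolP[nw _] := valP w.
  have w0 : val w != 0 by rewrite -normr_eq0 nw oner_eq0.
  apply: (mulIf w0); rewrite divfK // !val_polar.
  rewrite -[X in X = _](_ : (cos (d + angle w) +i* sin (d + angle w))%C = _).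
    by rewrite cosD sinD; congr (_ +i* _)%C; rewrite addrC.
  by rewrite /d subrK.
have /andP[z1 z2] := angle_range z; have /andP[w1 w2] := angle_range w.
have d1 : d < 2 * pi by rewrite /d; lra.
have d2 : - (2 * pi) < d by rewrite /d; lra.
have pi0 := pi_gt0 R; clearbody d.
have [d0|d0] := leP 0 d.
  rewrite (ger0_norm d0); case: leP => dpi.
    by rewrite arg_polar ?ger0_norm //; apply/andP; split; lra.
  rewrite -(subrK (pi *+ 2) d) cosD2pi sinD2pi.
  rewrite arg_polar; last by apply/andP; split; rewrite mulr2n; lra.
  by rewrite ler0_norm; rewrite mulr2n; lra.
rewrite (ltr0_norm d0); case: leP => dpi.
  (* The value [- pi] lies outside the range of [arg], which gives [pi] instead; the absolute value
     is the same. *)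
  have [e|ne] := eqVneq d (- pi).
    rewrite e cosN sinN sinpi oppr0 -(sinpi R).
    by rewrite arg_polar ?gtr0_norm ?lexx ?andbT; lra.
  rewrite arg_polar ?ltr0_norm //; apply/andP; split; last lra.
  by rewrite lt_neqAle eq_sym ne; lra.
rewrite -(cosD2pi d) -(sinD2pi d).
rewrite arg_polar; last by apply/andP; split; rewrite mulr2n; lra.
by rewrite gtr0_norm; rewrite mulr2n; lra.
Qed.

Lemma C3_adjE z w :
  C3 R z w = (2 / 3 * pi < `|angle z - angle w| < 4 / 3 * pi).
Proof.
have pi0 := pi_gt0 R.
rewrite /= /C3_adj /= arg_div; have [->|nzw] /= := eqVneq z w.
  by rewrite subrr normr0; apply/esym/negbTE; rewrite negb_and -!leNgt; lra.
have [d|d] := leP `|angle z - angle w| pi.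
  have -> : `|angle z - angle w| < 4 / 3 * pi by lra.
  by rewrite andbT.
have -> : 2 / 3 * pi < `|angle z - angle w| by lra.
by apply/idP/idP; lra.
Qed.

Lemma compl_C3E z w : compl (C3 R) z w =
  (z != w) && ~~ (2 / 3 * pi < `|angle z - angle w| < 4 / 3 * pi).
Proof. by rewrite -C3_adjE. Qed.

Definition third z : option bool :=
  if angle z < - (pi / 3) then None
  else Some (pi / 3 <= angle z).

Definition third_start (o : option bool) : R :=
  match o with
  | None => - pi
  | Some false => - (pi / 3)
  | Some true => pi / 3
  end.

Definition offset z : R := angle z - third_start (third z).

Lemma third_range z (o : option bool) : (third z == o) =
  (third_start o <= angle z < third_start o + 2 / 3 * pi).
Proof.
have /andP[z1 z2] := angle_range z; have pi0 := pi_gt0 R; rewrite /third.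
have [a1|a1] := ltP (angle z) (- (pi / 3)).
  by case: o => [[]|] /=; apply/idP/idP => // h; by [lra | exfalso; lra].
by have [a2|a2] := leP (pi / 3) (angle z);
  case: o => [[]|] /=; apply/idP/idP => // h; by [lra | exfalso; lra].
Qed.

Lemma offset_range z : 0 <= offset z < 2 / 3 * pi.
Proof.
have : third z == third z by []; rewrite third_range /offset.
by lra.
Qed.

Lemma third_clique z w : z != w -> third z = third w -> compl (C3 R) z w.
Proof.
move=> nzw e; rewrite compl_C3E nzw /=.
have := offset_range z; have := offset_range w; rewrite /offset e.
move: (third_start _) => s hw hz; rewrite negb_and -!leNgt.
by apply/orP; left; rewrite ler_norml; apply/andP; split; lra.
Qed.

(** Equal offsets would make the difference of two rational angles one of the multiples 2/3, 4/3,
    -2/3, -4/3 of [pi]. *)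
Lemma offset_neq z w : third z != third w -> offset z != offset w.
Proof.
have ne (m n : int) : (m%:~R / n%:~R : rat) != 0 ->
    angle z - angle w != m%:~R / n%:~R * pi.
  have [q ->] := angle_rat z; have [q' ->] := angle_rat w.
  move=> /(@pi_mul_neq_rat _ (q - q')).
  by rewrite rmorphB /= fmorph_div /= !ratr_int.
have := ne 2 3 isT; have := ne (-2) 3 isT.
have := ne 4 3 isT; have := ne (-4) 3 isT.
rewrite /offset => {ne} /eqP n1 /eqP n2 /eqP n3 /eqP n4 nk; apply/eqP.
case: (third z) (third w) nk => [[]|] [[]|] //= _ e;
  by [apply: n1; lra | apply: n2; lra | apply: n3; lra | apply: n4; lra].
Qed.

(** From [z] to [w] on the next arc one turns by [2 / 3 * pi + offset w - offset z], up to a full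
    turn, so comparing offsets decides adjacency; [offset_neq] gives strictness. *)
Lemma arrow_offset z w : arrow (compl (C3 R)) third z w -> offset z < offset w.
Proof.
move=> azw; have nk := arrow_neq azw.
have nzw : z != w by apply: contraNneq nk => ->.
rewrite lt_neqAle offset_neq //=; have pi0 := pi_gt0 R.
move: azw nk (offset_range z) (offset_range w).
rewrite arrowE compl_C3E nzw andTb /offset.
case: (third z) (third w) => [[]|] [[]|] //=; rewrite ?orbF ?negbK;
case: (ger0P (angle z - angle w)) => d + _ hz hw; lra.
Qed.

End CircleVertices.

(** * Placing finitely many vertices with prescribed arc, switching and order *)

Section Placement.
Variable R : realType.

(** The switching set: dense, and disjoint from its translate by 1/2. *)
Definition odd_denominator (x : R) : Prop :=
  exists (n : nat) (a : int), x = a%:~R / (n.*2.+1)%:R.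

(** Clearing denominators equates an odd integer with an even one. *)
Lemma odd_denominator_half (x : R) :
  odd_denominator x -> ~ odd_denominator (x + 1 / 2).
Proof.
move=> [n [a ->]] [m [b]].
have n0 : (n.*2.+1)%:R != 0 :> R by rewrite pnatr_eq0.
have m0 : (m.*2.+1)%:R != 0 :> R by rewrite pnatr_eq0.
move=> e; have : (a * 2 * (m.*2.+1)%:Z + (n.*2.+1)%:Z * (m.*2.+1)%:Z)%:~R
    = (b * 2 * (n.*2.+1)%:Z)%:~R :> R.
  rewrite intrD !intrM -!pmulrn.
  have -> : (b%:~R : R) = b%:~R / (m.*2.+1)%:R * (m.*2.+1)%:R by rewrite divfK.
  by rewrite -e; field.
by move/intr_inj; lia.
Qed.

Lemma odd_denominator_dense (x y : R) (e : bool) : x < y ->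
  exists q : rat, x < ratr q < y /\ `[< odd_denominator (ratr q) >] = e.
Proof.
have dense (a b : R) : a < b ->
    exists q : rat, a < ratr q < b /\ odd_denominator (ratr q).
  (* The odd [d] exceeds the inverse of [b - a], so the interval from [a * d] to [b * d] is longer
     than 1 and contains the integer after the floor of [a * d]. *)
  move=> ab; pose n := Num.truncn (b - a)^-1; pose d : R := (n.*2.+1)%:R.
  have d0 : 0 < d by rewrite ltr0n.
  have dab : 1 < (b - a) * d.
    rewrite -ltr_pdivrMl ?subr_gt0 // mulr1.
    apply: (lt_le_trans (truncnS_gt _)); rewrite ler_nat -/n.
    by lia.
  have /andP[f1 f2] := floor_itv (a * d).
  have qE : ratr ((Num.floor (a * d) + 1)%:~R / (n.*2.+1)%:R) =
      (Num.floor (a * d) + 1)%:~R / d :> R.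
    by rewrite fmorph_div /= ratr_int ratr_nat.
  exists ((Num.floor (a * d) + 1)%:~R / (n.*2.+1)%:R); rewrite qE; split.
    rewrite ltr_pdivlMr // f2 ltr_pdivrMr //.
    by rewrite intrD /=; lra.
  by exists n, (Num.floor (a * d) + 1).
case: e => xy.
  by have [q [h /asboolP]] := dense _ _ xy; exists q.
have [|q [h o]] := dense (x - 1 / 2) (y - 1 / 2); first lra.
exists (q + 1 / 2).
have -> : ratr (q + 1 / 2) = ratr q + 1 / 2 :> R.
  by rewrite rmorphD /= fmorph_div /= rmorph1 ratr_nat.
split; first lra.
by apply/asboolPn; exact: odd_denominator_half.
Qed.

Lemma angle_ex (q : rat) : - pi < (ratr q : R) < pi ->
  exists z : C3_vertex R, angle z = ratr q.
Proof.
move=> /andP[h1 h2].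
have argq : arg (cos (ratr q) +i* sin (ratr q))%C = ratr q :> R.
  by rewrite arg_polar // h1 ltW.
have /asboolP hz : `|cos (ratr q) +i* sin (ratr q)|%C = 1 :> R[i] /\
    exists q' : rat, arg (cos (ratr q) +i* sin (ratr q))%C = ratr q' :> R.
  by split; [rewrite norm_polar | exists q].
by exists (exist (fun z : R[i] =>
  `[< `|z| = 1 /\ exists q, arg z = ratr q >]) _ hz).
Qed.

Definition parity (z : C3_vertex R) : bool := `[< odd_denominator (angle z) >].

Lemma place_vertex (o : option bool) (e : bool) (x y : R) :
  0 <= x -> x < y -> y <= 2 / 3 * pi ->
  exists z : C3_vertex R, [/\ third z = o, parity z = e & x < offset z < y].
Proof.
move=> x0 xy y1; have pi0 := pi_gt0 R.
have [|q [/andP[h1 h2] h]] :=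
  @odd_denominator_dense (x + third_start R o) (y + third_start R o) e.
  by rewrite ltrD2r.
have [|z zq] := @angle_ex q.
  by apply/andP; split; case: o h1 h2 => [[]|] /=; lra.
have tz : third z = o by apply/eqP; rewrite third_range zq; lra.
by exists z; split; rewrite // /parity /offset ?zq ?tz //; lra.
Qed.

Lemma place_finite (T : finType) (k : T -> option bool) (t : T -> bool)
    (g : T -> nat) : exists f : T -> C3_vertex R,
  [/\ injective f, forall x, third (f x) = k x, forall x, parity (f x) = t x &
      forall x y, (g x < g y)%N -> offset (f x) < offset (f y)].
Proof.
(* [h] refines [g] and breaks its ties by [enum_rank], so each vertex gets its own slot and [f] is
   injective. *)
pose h x := (g x * #|T| + enum_rank x)%N.
have h_inj : injective h.
  move=> x y /(congr1 (modn^~ #|T|)).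
  by rewrite /h !modnMDl !modn_small ?ltn_ord // => /val_inj/enum_rank_inj.
have h_mono x y : (g x < g y)%N -> (h x < h y)%N.
  move=> gxy; rewrite /h; apply: (@leq_trans ((g x).+1 * #|T|)).
    by rewrite mulSn addnC ltn_add2r ltn_ord.
  by rewrite (leq_trans _ (leq_addr _ _)) // leq_mul.
(* [B] slots of width [u] fill an arc; slot [h x] ends at [u * (h x).+1], still within the arc. *)
pose B : R := (\max_x h x).+1%:R; pose u : R := 2 / 3 * pi / B.
have pi0 := pi_gt0 R.
have B0 : 0 < B by rewrite ltr0n.
have u0 : 0 < u by rewrite divr_gt0 //; lra.
have placed x : exists z, [/\ third z = k x, parity z = t x &
    u * (h x)%:R < offset z < u * (h x).+1%:R].
  apply: place_vertex.
  - by rewrite mulr_ge0 ?ler0n // ltW.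
  - by rewrite ltr_pM2l // ltr_nat.
  - rewrite -[leRHS](@divfK _ B) ?gt_eqF // -/u ler_pM2l // ler_nat ltnS.
    exact: leq_bigmax.
have [f fP] := choice placed.
have f_mono x y : (h x < h y)%N -> offset (f x) < offset (f y).
  have [_ _ /andP[_ h1]] := fP x; have [_ _ /andP[h2 _]] := fP y => hxy.
  apply: (lt_trans h1); apply: le_lt_trans h2.
  by rewrite ler_pM2l // ler_nat.
exists f; split=> [x y e|x|x|x y /h_mono/f_mono//]; try by have [] := fP x.
by apply: h_inj; apply/eqP; case: ltngtP => // /f_mono; rewrite e ltxx.
Qed.

End Placement.

Theorem theorem1p3 (R : realType) :
  exists sC : labelling (compl (C3 R)),
    anti_even_balancing sC /\
    forall (T : finType) (G : graph T),
      (~ exists S : {set T}, #|S| = 3%N /\ independent G S) ->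
      forall sG : labelling G, anti_even_balancing sG ->
      exists f : T -> C3_vertex R, label_embedding sG sC f.
Proof.
exists (thirds_labelling (compl (C3 R)) (@third R) (@parity R)); split.
  apply: thirds_anti_even_balancing; first exact: third_clique.
  exact: arrow_offset.
move=> T G noind s /anti_even_balancing_balanced bal.
have alpha x y z : x != y -> y != z -> x != z -> [|| G x y, G y z | G x z].
  move=> nxy nyz nxz; apply/negPn/negP; rewrite !negb_or => /and3P[xy yz xz].
  apply: noind; exists [set x; y; z]; split.
    by rewrite -finset.setUA cardsU1 !inE negb_or nxy nxz cards2 nyz.
  move=> a b; rewrite !inE -!orbA.
  by move=> /or3P[] /eqP-> /or3P[] /eqP->; rewrite ?adj_irr // adj_sym.
have [k [t [clq sE]]] := balanced_thirds bal alpha.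
have [g gP] := thirds_rank bal alpha clq sE.
have [f [f_inj fk ft fg]] := place_finite R k t g.
(* Otherwise the arrow would be reversed, against the order of the offsets. *)
have arrF x y : arrow G k x y -> arrow (compl (C3 R)) (@third R) (f x) (f y).
  move=> xy; rewrite arrowC ?fk ?(arrow_neq xy) //; apply/negP.
  by move=> /arrow_offset; rewrite ltNge ltW // fg // gP.
have adjF x y : compl (C3 R) (f x) (f y) = G x y.
  have [->|nxy] := eqVneq x y; first by rewrite !adj_irr.
  have [kxy|kxy] := eqVneq (k x) (k y).
    by rewrite clq // third_clique ?fk // inj_eq.
  (* For different classes the arrow determines adjacency, so equality of arrows is enough. *)
  have : arrow (compl (C3 R)) (@third R) (f x) (f y) = arrow G k x y.
    have [/arrF//|] := boolP (arrow G k x y).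
    by rewrite -arrowC 1?eq_sym // => /arrF/arrow_asym/negbTE.
  rewrite !arrowE !fk; move: (compl _ _ _) (G x y) => a b.
  by case: (k x) (k y) kxy a b => [[]|] [[]|] // _ [] [].
exists f; split=> // x y xy /=; rewrite /thirds_label !fk !ft -sE //.
by rewrite -Z2_bool.
Qed.
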